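(* Let $\sigma,\lambda\in\widehat{G}$ and $\alpha\in k$. Then, as $H$-modules: (a) $V_{\lambda}\otimes V_{\sigma}\cong V_{\lambda\sigma}$. (b) Assume $|\chi|=s<\infty$. Then $V_{\lambda}\otimes V(\sigma,\alpha)\cong V(\lambda\sigma,\alpha)$ and $V(\sigma,\alpha)\otimes V_{\lambda}\cong V(\sigma\lambda,\alpha\lambda(a)^s)$.
   Context: $k$ is a field, $G$ a group, $\widehat{G}$ the group of characters $G\to k^{\times}$, $\chi\in\widehat{G}$ of order $|\chi|$ (possibly $\infty$), and $a\in Z(G)$ with $\chi(a)\neq 1$. $H=kG(\chi^{-1},a,0)$ is the Hopf algebra generated as an algebra by $G$ and $x$ with relations $xg=\chi^{-1}(g)gx$ ($g\in G$), having $k$-basis $\{gx^i\mid g\in G,i\geq 0\}$, with $\Delta(x)=x\otimes a+1\otimes x$, $\varepsilon(x)=0$, $S(x)=-xa^{-1}$, and each $g\in G$ group-like. Tensor products of $H$-modules are over $k$, with $H$ acting through $\Delta$. $V_{\lambda}$ ($\lambda\in\widehat{G}$) is the $1$-dimensional $H$-module with $g\cdot v=\lambda(g)v$, $x\cdot v=0$. If $|\chi|=s<\infty$, $\lambda\in\widehat{G}$ and $\gamma\in k$, then $V(\lambda,\gamma)$ is the $H$-module with $k$-basis $m_0,\dots,m_{s-1}$ and action $g\cdot m_i=\chi^i(g)\lambda(g)m_i$; $x\cdot m_i=m_{i+1}$ for $0\leq i\leq s-2$; $x\cdot m_{s-1}=\gamma m_0$. *)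

(* Defs.v *)
From HB Require Import structures.
From mathcomp Require Import all_boot all_algebra.
From mathcomp Require Import sesquilinear boolp freeg.

Set Implicit Arguments.
Unset Strict Implicit.
Unset Printing Implicit Defensive.

Import GRing.Theory.
Local Open Scope ring_scope.
Local Open Scope quotient_scope.

Section FreeModule.
Context (k : nzRingType) (I : choiceType).
Local Notation F := {freeg I / k}.
Local Notation fg i := (<< i >> : F).

Lemma fgZU c (i : I) : c *: fg i = << c *g i >>.
Proof.
apply/eqP/freeg_eqP => j; rewrite coeffZ !coeffU mul1r; by [].
Qed.

Lemma fg_ind (P : F -> Prop) :
  P 0 -> (forall c i x, P x -> P (c *: fg i + x)) -> forall x, P x.
Proof.
move=> P0 PS x; rewrite -[x]freeg_sumE.
elim: (dom x) => [|i s IHs]; first by rewrite big_nil.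
by rewrite big_cons -fgZU; apply: PS.
Qed.

Context (V : lmodType k).
Implicit Type f : I -> V.

Lemma fgliftU1 f i : fglift f (fg i) = f i.
Proof. by rewrite liftU scale1r. Qed.

Lemma fglift0 f : fglift f (0 : F) = 0.
Proof. by rewrite -(subrr (0 : F)) lift_is_additive subrr. Qed.

Lemma fglift_linear f : linear (fglift f : F -> V).
Proof.
have B := @lift_is_additive _ _ _ f.
have f0 := fglift0 f.
have D x y : fglift f (x + y) = fglift f x + fglift f y.
  by rewrite -{1}[y]opprK B -[- y]add0r B f0 sub0r opprK.
move=> c x y; rewrite D; congr (_ + _); elim/fg_ind: x => [|d i x IHx].
  by rewrite scaler0 f0 scaler0.
by rewrite scalerDr !D IHx scalerA !fgZU !liftU scalerDr scalerA.
Qed.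

Lemma linear_fglift (g : {linear F -> V}) x : g x = fglift (fun i => g (fg i)) x.
Proof.
elim/fg_ind: x => [|c i x IHx].
  by rewrite linear0 fglift0.
by rewrite linearP fglift_linear IHx fgliftU1.
Qed.

End FreeModule.

Section TensorProduct.
Context (k : fieldType) (U V : lmodType k).
Local Notation F := {freeg (U * V)%type / k}.
Local Notation fg u v := (<< (u, v) >> : F).

(* [tens U V] is the quotient of the free k-module on U * V by the smallest
   submodule modulo which (u, v) |-> <<(u, v)>> is bilinear; [tens_sub S] says
   that the predicate S is a submodule containing the bilinearity relators. *)
Definition tens_sub (S : F -> Prop) := [/\ S 0,
  forall c x y, S x -> S y -> S (c *: x + y),
  forall c u u' v, S (fg (c *: u + u') v - (c *: fg u v + fg u' v)) &
  forall c u v v', S (fg u (c *: v + v') - (c *: fg u v + fg u v'))].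

Definition tens_rel : {pred F} := fun x => `[< forall S, tens_sub S -> S x >].

Lemma tens_relP x : reflect (forall S, tens_sub S -> S x) (x \in tens_rel).
Proof. exact: asboolP. Qed.

Lemma tens_rel_submod_closed : submod_closed tens_rel.
Proof.
split; first by apply/tens_relP => S [].
move=> c x y /tens_relP hx /tens_relP hy; apply/tens_relP => S hS.
by case: (hS) => _ SZ _ _; apply: SZ; [exact: hx | exact: hy].
Qed.
HB.instance Definition _ :=
  GRing.isSubmodClosed.Build k F tens_rel tens_rel_submod_closed.

Definition tens : Type := Quotient.quot tens_rel.
HB.instance Definition _ := GRing.Zmodule.on tens.

Let pi (x : F) : tens := \pi_(Quotient.quot tens_rel) x.

Let pi_eq x y : x - y \in tens_rel -> pi x = pi y.
Proof. by move=> h; apply/eqP; rewrite -Quotient.idealrBE. Qed.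

Let piK (t : tens) : pi (repr t) = t.
Proof. exact: reprK. Qed.

Let repr_pi (x : F) : repr (pi x) - x \in tens_rel.
Proof. by rewrite Quotient.idealrBE; apply/eqP; exact: reprK. Qed.

Let piB x y : pi (x - y) = pi x - pi y.
Proof. by rewrite /pi raddfB. Qed.

Let pi0 : pi 0 = 0. Proof. by rewrite -(subrr 0) piB subrr. Qed.

Let piD x y : pi (x + y) = pi x + pi y.
Proof. by rewrite -{1}[y]opprK piB -[- y]add0r piB pi0 sub0r opprK. Qed.

Definition tens_scale (c : k) (t : tens) : tens := pi (c *: repr t).

Let piZ c x : tens_scale c (pi x) = pi (c *: x).
Proof. by apply: pi_eq; rewrite -scalerBr rpredZ. Qed.

Lemma tens_scaleA a b t : tens_scale a (tens_scale b t) = tens_scale (a * b) t.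
Proof. by rewrite -[t]piK !piZ scalerA. Qed.
Lemma tens_scale1 : left_id 1 tens_scale.
Proof. by move=> t; rewrite -[t]piK piZ scale1r. Qed.
Lemma tens_scaleDr : right_distributive tens_scale +%R.
Proof. by move=> a s t; rewrite -[s]piK -[t]piK -piD !piZ -piD scalerDr. Qed.
Lemma tens_scaleDl t : {morph tens_scale^~ t : a b / a + b}.
Proof. by move=> a b; rewrite -[t]piK !piZ -piD scalerDl. Qed.

HB.instance Definition _ := GRing.Zmodule_isLmodule.Build k tens
  tens_scaleA tens_scale1 tens_scaleDr tens_scaleDl.

Let pi_scale c x : c *: pi x = pi (c *: x). Proof. exact: piZ. Qed.

Definition tensor (u : U) (v : V) : tens := \pi_(Quotient.quot tens_rel) << (u, v) >>.

Lemma tensor_bilinear : bilinear_for *:%R *:%R tensor.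
Proof.
split=> [v c u u' | u c v v'] /=; rewrite /tensor -!/(pi _);
  rewrite pi_scale -piD; apply: pi_eq;
  by apply/tens_relP => S [_ _ Sl Sr]; (apply: Sl || apply: Sr).
Qed.

HB.instance Definition _ := bilinear_isBilinear.Build k U V tens
  *:%R *:%R tensor tensor_bilinear.

Lemma tens_ind (P : tens -> Prop) :
  P 0 -> (forall u v t, P t -> P (tensor u v + t)) -> forall t, P t.
Proof.
move=> P0 PS t; rewrite -[t]piK; elim/fg_ind: (repr t) => [|c [u v] x IHx].
  by rewrite pi0.
rewrite piD -pi_scale -[pi << _ >>]/(tensor u v) -linearZl_LR; exact: PS.
Qed.

Section Lift.
Context (W : lmodType k) (f : U -> V -> W).

Definition tens_lift (t : tens) : W := fglift (fun p => f p.1 p.2) (repr t).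

Hypothesis fB : bilinear_for *:%R *:%R f.

Let flift := fglift (fun p : U * V => f p.1 p.2).

Let tens_lift_pi x : tens_lift (pi x) = flift x.
Proof.
have fL := fglift_linear (fun p : U * V => f p.1 p.2).
suff : flift (repr (pi x) - x) = 0.
  by rewrite /flift lift_is_additive => /eqP; rewrite subr_eq0 => /eqP.
apply: (tens_relP _ (repr_pi x) (fun x => flift x = 0)); split=> /=.
- exact: fglift0.
- by move=> c y z y0 z0; rewrite /flift fL [fglift _ y]y0 [fglift _ z]z0 scaler0 addr0.
- move=> c u u' v; rewrite /flift lift_is_additive fL !fgliftU1 /=.
  by rewrite (fB.1 v) subrr.
- move=> c u v v'; rewrite /flift lift_is_additive fL !fgliftU1 /=.
  by rewrite (fB.2 u) subrr.
Qed.

Lemma tens_lift_linear : linear tens_lift.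
Proof.
move=> c s t; rewrite -[s]piK -[t]piK pi_scale -piD.
by rewrite !tens_lift_pi [LHS]fglift_linear.
Qed.

Lemma tens_liftE u v : tens_lift (tensor u v) = f u v.
Proof. by rewrite tens_lift_pi /flift fgliftU1. Qed.

End Lift.
End TensorProduct.


Section Linear.
Context (k : pzRingType) (U V : lmodType k) (f : U -> V).
Hypothesis fL : linear f.
Lemma lin0 : f 0 = 0.
Proof. by have := fL (-1) 0 0; rewrite scaleN1r oppr0 addr0 scaleN1r addNr. Qed.
Lemma linD x y : f (x + y) = f x + f y.
Proof. by have := fL 1 x y; rewrite !scale1r. Qed.
Lemma linZ c x : f (c *: x) = c *: f x.
Proof. by have := fL c x 0; rewrite !addr0 lin0 addr0. Qed.
End Linear.

Lemma tens_linear_ext (k : fieldType) (U V W : lmodType k)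
    (f g : tens U V -> W) : linear f -> linear g ->
  (forall u v, f (tensor u v) = g (tensor u v)) -> f =1 g.
Proof.
move=> fL gL fg; apply: tens_ind => [|u v t IHt]; first by rewrite !lin0.
by rewrite !linD // fg IHt.
Qed.

(* For bilinear f : A -> U -> U' and g : B -> V -> V', [tens_map2 f g] is the
   bilinear map with (a (x) b, u (x) v) |-> f a u (x) g b v; it gives both the
   product of A (x) B and the action of A (x) B on U (x) V. *)
Section TensorMap.
Context (k : fieldType) (A B U V U' V' : lmodType k).
Context (f : A -> U -> U') (g : B -> V -> V').
Hypotheses (fB : bilinear_for *:%R *:%R f) (gB : bilinear_for *:%R *:%R g).

Definition tens_map2 (s : tens A B) (t : tens U V) : tens U' V' :=
  tens_lift (fun a b => tens_lift (fun u v => tensor (f a u) (g b v)) t) s.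

Let inB a b : bilinear_for *:%R *:%R (fun u v => tensor (f a u) (g b v)).
Proof.
split=> [v c u u' | u c v v'] /=; first by rewrite fB.2 linearPl.
by rewrite gB.2 linearPr.
Qed.

Let inL a b := tens_lift_linear (inB a b).

Let outB t : bilinear_for *:%R *:%R
  (fun a b => tens_lift (fun u v => tensor (f a u) (g b v)) t).
Proof.
split=> [b c a a' | a c b b'] /=; elim/tens_ind: t => [|u v t IHt];
  rewrite ?(lin0 (inL (c *: a + a') _), lin0 (inL _ (c *: b + b')),
    lin0 (inL _ _)) ?(lin0 (inL _ _)) ?(lin0 (inL _ _)) ?scaler0 ?addr0 //;
  rewrite !(linD (inL _ _)) IHt !(tens_liftE (inB _ _)) ?fB.1 ?gB.1 ?linearPl ?linearPr;
  by rewrite scalerDr addrACA.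
Qed.

Lemma tens_map2_bilinear : bilinear_for *:%R *:%R tens_map2.
Proof.
split=> [t | s]; first exact: (tens_lift_linear (outB t)).
have t0 t : tens_map2 0 t = 0 by exact: (lin0 (tens_lift_linear (outB t))).
have tD s1 s2 t : tens_map2 (s1 + s2) t = tens_map2 s1 t + tens_map2 s2 t.
  exact: (linD (tens_lift_linear (outB t))).
have tE a b t : tens_map2 (tensor a b) t =
  tens_lift (fun u v => tensor (f a u) (g b v)) t by exact: (tens_liftE (outB t)).
move=> c t t' /=; elim/tens_ind: s => [|a b s IHs].
  by rewrite !t0 scaler0 addr0.
by rewrite !tD IHs !tE inL scalerDr addrACA.
Qed.

Lemma tens_map2E a b u v :
  tens_map2 (tensor a b) (tensor u v) = tensor (f a u) (g b v).
Proof. by rewrite /tens_map2 (tens_liftE (outB _)) (tens_liftE (inB _ _)). Qed.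

End TensorMap.

Lemma mulr_bilinear (k : fieldType) (A : algType k) :
  bilinear_for *:%R *:%R (@GRing.mul A).
Proof.
split=> [b c a a' | a c b b'] /=; first by rewrite mulrDl scalerAl.
by rewrite mulrDr scalerAr.
Qed.

Section TensorAlgebra.
Context (k : fieldType) (A B : algType k).
Local Notation T := (tens A B).

(* Only a pzRingType structure is given to A (x) B: a library algType must in
   addition be nonzero. *)
Definition tens_mul : T -> T -> T := tens_map2 (@GRing.mul A) (@GRing.mul B).

Let mB : bilinear_for *:%R *:%R tens_mul.
Proof. exact/tens_map2_bilinear/mulr_bilinear/mulr_bilinear. Qed.
Let m0l t : tens_mul 0 t = 0. Proof. exact: lin0 (mB.1 t). Qed.
Let m0r t : tens_mul t 0 = 0. Proof. exact: lin0 (mB.2 t). Qed.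
Let mDl r s t : tens_mul (s + t) r = tens_mul s r + tens_mul t r.
Proof. exact: linD (mB.1 r) _ _. Qed.
Let mDr r s t : tens_mul r (s + t) = tens_mul r s + tens_mul r t.
Proof. exact: linD (mB.2 r) _ _. Qed.

Lemma tens_mulE a b a' b' :
  tens_mul (tensor a b) (tensor a' b') = tensor (a * a') (b * b').
Proof. exact/tens_map2E/mulr_bilinear/mulr_bilinear. Qed.

Lemma tens_mulA : associative tens_mul.
Proof.
move=> s t r; elim/tens_ind: s => [|a b s IHs]; first by rewrite !m0l.
rewrite !mDl IHs; congr (_ + _) => {s IHs}.
elim/tens_ind: t => [|a' b' t IHt]; first by rewrite m0l m0r m0l.
rewrite mDl !mDr mDl IHt; congr (_ + _) => {t IHt}.
elim/tens_ind: r => [|a2 b2 r IHr]; first by rewrite !m0r.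
by rewrite !mDr IHr !tens_mulE !mulrA.
Qed.

Lemma tens_mul1 : left_id (tensor 1 1) tens_mul.
Proof.
elim/tens_ind=> [|a b t IHt]; first by rewrite m0r.
by rewrite mDr IHt tens_mulE !mul1r.
Qed.

Lemma tens_1mul : right_id (tensor 1 1) tens_mul.
Proof.
elim/tens_ind=> [|a b t IHt]; first by rewrite m0l.
by rewrite mDl IHt tens_mulE !mulr1.
Qed.

HB.instance Definition _ := GRing.Zmodule_isPzRing.Build T
  tens_mulA tens_mul1 tens_1mul
  (fun s t r => mDl r s t) mDr.

Lemma tensM (a a' : A) (b b' : B) :
  tensor a b * tensor a' b' = tensor (a * a') (b * b').
Proof. exact: tens_mulE. Qed.

Lemma tens1 : 1 = tensor 1 1 :> T. Proof. by []. Qed.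

End TensorAlgebra.

Definition tens_assoc (k : fieldType) (U V W : lmodType k)
    : tens (tens U V) W -> tens U (tens V W) :=
  tens_lift (fun s w => tens_lift (fun u v => tensor u (tensor v w)) s).

Definition tens_map (k : fieldType) (U V U' V' : lmodType k)
    (f : U -> U') (g : V -> V') : tens U V -> tens U' V' :=
  tens_lift (fun u v => tensor (f u) (g v)).

(* [tens_lift], hence [tens_map], is the induced linear map only when its
   argument is bilinear, resp. its arguments are linear, as is the case for all
   the uses below. *)
HB.mixin Record isHopfAlgebra (k : fieldType) H of GRing.Algebra k H := {
  comul : H -> tens H H;
  counit : H -> k;
  antipode : H -> H;
  comul_linear : linear comul;
  comul_morphism : monoid_morphism comul;
  counit_linear : scalar counit;
  counit_morphism : monoid_morphism counit;
  antipode_linear : linear antipode;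
  comulA : forall h,
    tens_assoc (tens_map comul id (comul h)) = tens_map id comul (comul h);
  counitl : forall h, tens_lift (fun h1 h2 => counit h1 *: h2) (comul h) = h;
  counitr : forall h, tens_lift (fun h1 h2 => counit h2 *: h1) (comul h) = h;
  antipodel : forall h,
    tens_lift (fun h1 h2 => antipode h1 * h2) (comul h) = (counit h)%:A;
  antipoder : forall h,
    tens_lift (fun h1 h2 => h1 * antipode h2) (comul h) = (counit h)%:A;
}.
#[short(type="hopfAlgType")]
HB.structure Definition HopfAlgebra (k : fieldType) :=
  {H of GRing.Algebra k H & isHopfAlgebra k H}.

(* A module over a k-algebra A, seen as a k-vector space. *)
Definition restrict_scalars (k : fieldType) (A : algType k) (M : lmodType A)
  : Type := M.

Section RestrictScalars.
Context (k : fieldType) (A : algType k) (M : lmodType A).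
Local Notation M' := (restrict_scalars M).
HB.instance Definition _ := GRing.Zmodule.on M'.

Let scale (c : k) (m : M') : M' := (c%:A : A) *: (m : M).
Let scaleA a b m : scale a (scale b m) = scale (a * b) m.
Proof. by rewrite /scale [LHS]scalerA -scalerAl mul1r scalerA. Qed.
Let scale1 : left_id 1 scale.
Proof. by move=> m; rewrite /scale scale1r [LHS]scale1r. Qed.
Let scaleDr : right_distributive scale +%R.
Proof. by move=> a s t; rewrite /scale [LHS]scalerDr. Qed.
Let scaleDl t : {morph scale^~ t : a b / a + b}.
Proof. by move=> a b; rewrite /scale scalerDl [LHS]scalerDl. Qed.
HB.instance Definition _ :=
  GRing.Zmodule_isLmodule.Build k M' scaleA scale1 scaleDr scaleDl.

Lemma restrict_scaleE (c : k) (m : M') : c *: m = (c%:A : A) *: (m : M).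
Proof. by []. Qed.

Lemma restrict_bilinear :
  bilinear_for *:%R *:%R (fun (h : A) (m : M') => h *: (m : M) : M').
Proof.
have sE (c : k) (n : M) : (c *: (n : M') : M') = (c%:A : A) *: n by [].
split=> [m c h h' | h c m m'] /=; rewrite !sE.
  by rewrite [LHS](scalerDl (m : M)) scalerA mulr_algl.
by rewrite [LHS](scalerDr h (_ : M)) !scalerA mulr_algl mulr_algr.
Qed.
End RestrictScalars.

Definition hmod_tens (k : fieldType) (H : hopfAlgType k) (M N : lmodType H)
  : Type := tens (restrict_scalars M) (restrict_scalars N).

Section HmodTensor.
Context (k : fieldType) (H : hopfAlgType k) (M N : lmodType H).
Local Notation M' := (restrict_scalars M).
Local Notation N' := (restrict_scalars N).
Local Notation T := (tens M' N').

Definition tens_act : tens H H -> T -> T :=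
  tens_map2 (fun (h : H) (m : M') => h *: (m : M) : M')
            (fun (h : H) (n : N') => h *: (n : N) : N').

Let aB : bilinear_for *:%R *:%R tens_act.
Proof. exact/tens_map2_bilinear/restrict_bilinear/restrict_bilinear. Qed.
Let a0l t : tens_act 0 t = 0. Proof. exact: lin0 (aB.1 t). Qed.
Let a0r t : tens_act t 0 = 0. Proof. exact: lin0 (aB.2 t). Qed.
Let aDl r s t : tens_act (s + t) r = tens_act s r + tens_act t r.
Proof. exact: linD (aB.1 r) _ _. Qed.
Let aDr r s t : tens_act r (s + t) = tens_act r s + tens_act r t.
Proof. exact: linD (aB.2 r) _ _. Qed.

Lemma tens_actE (h h' : H) (m : M) (n : N) :
  tens_act (tensor h h') (tensor (m : M') (n : N')) =
  tensor (h *: m : M') (h' *: n : N').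
Proof. exact/tens_map2E/restrict_bilinear/restrict_bilinear. Qed.

Lemma tens_actM s s' t : tens_act s (tens_act s' t) = tens_act (s * s') t.
Proof.
elim/tens_ind: s => [|a b s IHs]; first by rewrite mul0r !a0l.
rewrite mulrDl !aDl IHs; congr (_ + _) => {s IHs}.
elim/tens_ind: s' => [|a' b' s' IHs']; first by rewrite mulr0 !a0l a0r.
rewrite mulrDr !aDl aDr IHs'; congr (_ + _) => {s' IHs'}.
elim/tens_ind: t => [|m n t IHt]; first by rewrite !a0r.
by rewrite !aDr IHt tensM !tens_actE !scalerA.
Qed.

Lemma tens_act1 t : tens_act 1 t = t.
Proof.
elim/tens_ind: t => [|m n t IHt]; first by rewrite !a0r.
by rewrite aDr IHt tens1 tens_actE !scale1r.
Qed.

HB.instance Definition _ := GRing.Zmodule.on (hmod_tens M N).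

Let act (h : H) (t : T) : T := tens_act (comul h) t.
Let actA a b t : act a (act b t) = act (a * b) t.
Proof. by rewrite /act tens_actM comul_morphism.2. Qed.
Let act1 : left_id 1 act.
Proof. by move=> t; rewrite /act comul_morphism.1 tens_act1. Qed.
Let actDr : right_distributive act +%R.
Proof. by move=> h s t; rewrite /act aDr. Qed.
Let actDl t : {morph act^~ t : a b / a + b}.
Proof. by move=> a b; rewrite /act (linD comul_linear) aDl. Qed.
HB.instance Definition _ := GRing.Zmodule_isLmodule.Build H (hmod_tens M N)
  actA act1 actDr actDl.

Lemma hmod_tens_scaleE (h : H) (t : hmod_tens M N) :
  h *: t = tens_act (comul h) t.
Proof. by []. Qed.
End HmodTensor.

Definition hmod_iso (R : pzRingType) (M N : lmodType R) : Prop :=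
  exists f : {linear M -> N}, bijective f.

(* The values of a character are automatically nonzero (char_neq0), so this is
   the same as a group morphism to the units of k. *)
Record character (k : fieldType) (G : groupType) := Character {
  char_val :> G -> k;
  char1 : char_val 1%g = 1;
  charM : forall g h, char_val (g * h)%g = char_val g * char_val h }.

Section CharacterGroup.
Context (k : fieldType) (G : groupType).
Implicit Types lambda mu nu : character k G.

Lemma char_eq lambda mu : lambda =1 mu -> lambda = mu.
Proof.
case: lambda mu => [f f1 fM] [g g1 gM] /= /funext fg; subst g.
by congr Character; exact: Prop_irrelevance.
Qed.

Lemma char_neq0 lambda g : lambda g != 0.
Proof.
apply/eqP => lg0; have /eqP := char1 lambda.
by rewrite -(mulgV g) charM lg0 mul0r eq_sym oner_eq0.
Qed.

HB.instance Definition _ := gen_eqMixin (character k G).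
HB.instance Definition _ := gen_choiceMixin (character k G).

Program Definition char_one : character k G := @Character k G (fun=> 1) _ _.
Next Obligation. by rewrite mulr1. Qed.

Program Definition char_mul lambda mu : character k G :=
  @Character k G (fun g => lambda g * mu g) _ _.
Next Obligation. by rewrite !char1 mulr1. Qed.
Next Obligation. by rewrite !charM mulrACA. Qed.

Program Definition char_inv lambda : character k G :=
  @Character k G (fun g => (lambda g)^-1) _ _.
Next Obligation. by rewrite char1 invr1. Qed.
Next Obligation. by rewrite charM invfM. Qed.

Fact char_mulA : associative char_mul.
Proof. by move=> x y z; apply: char_eq => g /=; rewrite mulrA. Qed.
Fact char_mul1 : left_id char_one char_mul.
Proof. by move=> x; apply: char_eq => g /=; rewrite mul1r. Qed.
Fact char_1mul : right_id char_one char_mul.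
Proof. by move=> x; apply: char_eq => g /=; rewrite mulr1. Qed.
Fact char_mulV : left_inverse char_one char_inv char_mul.
Proof. by move=> x; apply: char_eq => g /=; rewrite mulVf ?char_neq0. Qed.
Fact char_Vmul : right_inverse char_one char_inv char_mul.
Proof. by move=> x; apply: char_eq => g /=; rewrite mulfV ?char_neq0. Qed.

HB.instance Definition _ := isGroup.Build (character k G)
  char_mulA char_mul1 char_1mul char_mulV char_Vmul.

Lemma char_XE lambda n g : (lambda ^+ n)%g g = lambda g ^+ n.
Proof.
elim: n => [|n IHn]; first by rewrite expg0 expr0.
by rewrite expgS exprS -IHn.
Qed.

End CharacterGroup.

Definition has_order (T : groupType) (x : T) (s : nat) : Prop :=
  [/\ (0 < s)%N, (x ^+ s)%g = 1%g &
      forall t, (0 < t)%N -> (x ^+ t)%g = 1%g -> (s <= t)%N].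

(* [fglift b] sends the formal combination \sum_i c_i <<i>> to
   \sum_i c_i *: b i. *)
Definition is_basis (k : nzRingType) (V : lmodType k) (I : choiceType)
  (b : I -> V) : Prop := bijective (fglift b : {freeg I / k} -> V).

(* The relations, together with the basis condition, say that H is the algebra
   generated by G and x subject to x g = chi^-1(g) g x. *)
Record ore_hopf (k : fieldType) (G : groupType) (chi : character k G) (a : G)
    (H : hopfAlgType k) := OreHopf {
  og : G -> H;
  ox : H;
  og1 : og 1%g = 1;
  ogM : forall g h, og (g * h)%g = og g * og h;
  oxg : forall g, ox * og g = (chi^-1)%g g *: (og g * ox);
  ore_basis : is_basis (fun p : G * nat => og p.1 * ox ^+ p.2);
  comul_og : forall g, comul (og g) = tensor (og g) (og g);
  counit_og : forall g, counit (og g) = 1;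
  comul_ox : comul ox = tensor ox (og a) + tensor 1 ox;
  counit_ox : counit ox = 0;
  antipode_ox : antipode ox = - (ox * og (a^-1)%g) }.

Section OreModules.
Context (k : fieldType) (G : groupType) (chi : character k G) (a : G).
Context (H : hopfAlgType k) (P : ore_hopf chi a H).

Let b (p : G * nat) : H := og P p.1 * ox P ^+ p.2.

Let coord_sig (h : H) : {c : {freeg (G * nat)%type / k} | fglift b c = h}.
Proof. by apply: cid; case: (ore_basis P) => c _ cK; exists (c h). Qed.
Let coord h := sval (coord_sig h).
Let coordK h : fglift b (coord h) = h. Proof. exact: svalP (coord_sig h). Qed.
Let fgK c : coord (fglift b c) = c.
Proof. by apply: (bij_inj (ore_basis P)); rewrite -/b coordK. Qed.

Let coordL : linear coord.
Proof. by move=> c h h'; rewrite -{1}[h]coordK -{1}[h']coordK -fglift_linear fgK. Qed.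

Let ore_ind (Q : H -> Prop) :
  Q 0 -> (forall c p h, Q h -> Q (c *: b p + h)) -> forall h, Q h.
Proof.
move=> Q0 QS h; rewrite -[h]coordK; elim/fg_ind: (coord h) => [|c i x IHx].
  by rewrite fglift0.
by rewrite fglift_linear fgliftU1; apply: QS.
Qed.

Section Action.
Context (V : lmodType k) (u : G -> V -> V) (y : V -> V).
Hypotheses (uL : forall g, linear (u g)) (yL : linear y).
Hypotheses (u1 : forall v, u 1%g v = v).
Hypotheses (uM : forall g h v, u (g * h)%g v = u g (u h v)).
Hypotheses (yu : forall g v, y (u g v) = (chi^-1)%g g *: u g (y v)).

(* The unique H-action on V in which g in G acts by u g and x acts by y; it is
   read off the basis g x^i. *)
Definition ore_act (h : H) (v : V) : V :=
  fglift (fun p : G * nat => u p.1 (iter p.2 y v)) (coord h).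

Lemma ore_actPl c h h' v :
  ore_act (c *: h + h') v = c *: ore_act h v + ore_act h' v.
Proof. by rewrite /ore_act coordL fglift_linear. Qed.

Lemma ore_act0l v : ore_act 0 v = 0.
Proof. by rewrite /ore_act (lin0 coordL) fglift0. Qed.

Lemma ore_actZ c h v : ore_act (c *: h) v = c *: ore_act h v.
Proof. by have := ore_actPl c h 0 v; rewrite ore_act0l !addr0. Qed.

Lemma ore_actE g i v : ore_act (og P g * ox P ^+ i) v = u g (iter i y v).
Proof.
rewrite -[_ * _]/(b (g, i)) /ore_act -(fgliftU1 b) fgK.
by rewrite fgliftU1.
Qed.

Lemma ore_act_og g v : ore_act (og P g) v = u g v.
Proof. by have := ore_actE g 0 v; rewrite expr0 mulr1. Qed.

Lemma ore_act_ox v : ore_act (ox P) v = y v.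
Proof. by have := ore_actE 1%g 1 v; rewrite expr1 og1 mul1r u1. Qed.

Let yiL i : linear (iter i y).
Proof. by elim: i => [|i IHi] c v w //=; rewrite IHi yL. Qed.

Lemma ore_actPr h : linear (ore_act h).
Proof.
move=> c v w; elim/ore_ind: h => [|d [g i] h IHh].
  by rewrite !ore_act0l scaler0 addr0.
rewrite !ore_actPl IHh !ore_actE yiL uL !scalerDr !scalerA [d * c]mulrC.
by rewrite addrACA.
Qed.

Let oxXg i g :
  ox P ^+ i * og P g = (chi^-1)%g g ^+ i *: (og P g * ox P ^+ i).
Proof.
elim: i => [|i IHi]; first by rewrite !expr0 mul1r mulr1 scale1r.
have -> : ox P ^+ i.+1 * og P g = ox P * (ox P ^+ i * og P g).
  by rewrite exprS mulrA.
by rewrite IHi -scalerAr [ox P * (_ * _)]mulrA oxg -scalerAl scalerA -exprSr -mulrA -exprS.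
Qed.

Let yiu i g v : iter i y (u g v) = (chi^-1)%g g ^+ i *: u g (iter i y v).
Proof.
elim: i => [|i IHi] /=; first by rewrite scale1r.
by rewrite IHi (linZ yL) yu scalerA -exprSr.
Qed.

Lemma ore_actM h h' v : ore_act h (ore_act h' v) = ore_act (h * h') v.
Proof.
elim/ore_ind: h => [|c [g i] h IHh]; first by rewrite mul0r !ore_act0l.
rewrite mulrDl -scalerAl !ore_actPl IHh; congr (_ *: _ + _) => {h IHh}.
elim/ore_ind: h' => [|d [g' j] h IHh].
  by rewrite mulr0 !ore_act0l (lin0 (ore_actPr _)).
rewrite mulrDr -scalerAr !ore_actPl ore_actPr IHh; congr (_ *: _ + _).
rewrite /b /= !ore_actE yiu (linZ (uL _)) -uM -iterD.
rewrite mulrA -[_ * _ * og _ g']mulrA oxXg -scalerAr -scalerAl !mulrA -ogM.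
by rewrite -mulrA -exprD ore_actZ ore_actE.
Qed.

Lemma ore_act1 : left_id 1 ore_act.
Proof. by move=> v; rewrite -(og1 P) ore_act_og. Qed.

Lemma ore_actDr : right_distributive ore_act +%R.
Proof. by move=> h v w; exact: linD (ore_actPr h) v w. Qed.

Lemma ore_actDl v : {morph ore_act^~ v : h h' / h + h'}.
Proof. by move=> h h'; have := ore_actPl 1 h h' v; rewrite !scale1r. Qed.

End Action.

End OreModules.

(* The carrier k has basis 1; the action is given by char_mod_og, char_mod_ox
   and char_mod_scale. *)
Definition char_mod (k : fieldType) (G : groupType) (chi : character k G)
  (a : G) (H : hopfAlgType k) (P : ore_hopf chi a H) (lambda : character k G)
  : Type := k.

Section CharMod.
Context (k : fieldType) (G : groupType) (chi : character k G) (a : G).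
Context (H : hopfAlgType k) (P : ore_hopf chi a H) (lambda : character k G).
Local Notation V := (char_mod P lambda).

Let u (g : G) (v : k^o) : k^o := lambda g *: v.
Let y (v : k^o) : k^o := 0.

Let uL g : linear (u g).
Proof. by move=> c v w; rewrite /u scalerDr !scalerA mulrC. Qed.
Let yL : linear y. Proof. by move=> c v w; rewrite /y scaler0 addr0. Qed.
Let u1 v : u 1%g v = v. Proof. by rewrite /u char1 scale1r. Qed.
Let uM g h v : u (g * h)%g v = u g (u h v).
Proof. by rewrite /u charM scalerA. Qed.
Let yu g v : y (u g v) = (chi^-1)%g g *: u g (y v).
Proof. by rewrite /u /y !scaler0. Qed.

HB.instance Definition _ := GRing.Zmodule.copy V k.
HB.instance Definition _ := GRing.Zmodule_isLmodule.Build H V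
  (ore_actM P uL yL uM yu) (ore_act1 P _ u1) (ore_actDr P uL yL)
  (ore_actDl P u y).

Lemma char_mod_og g (v : V) : og P g *: v = lambda g * (v : k) :> k.
Proof. exact: (ore_act_og P u y). Qed.

Lemma char_mod_ox (v : V) : ox P *: v = 0.
Proof. exact: (ore_act_ox P y u1). Qed.

Lemma char_mod_scale (c : k) (v : V) : (c%:A : H) *: v = c * (v : k) :> k.
Proof.
rewrite -(og1 P) [LHS](ore_actZ P u y) ore_act_og [u _ _]u1; by [].
Qed.

End CharMod.

(* The carrier has basis [cyc_basis s 0], ..., [cyc_basis s s.-1], the canonical
   basis of column vectors; the action on it is given by cyc_mod_og, cyc_mod_ox,
   cyc_mod_ox_last and cyc_mod_scale. *)
Definition cyc_mod (k : fieldType) (G : groupType) (chi : character k G)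
  (a : G) (H : hopfAlgType k) (P : ore_hopf chi a H) (s : nat)
  (ord_chi : has_order chi s) (lambda : character k G) (gamma : k) : Type :=
  'cV[k]_s.

Section CycMod.
Context (k : fieldType) (G : groupType) (chi : character k G) (a : G).
Context (H : hopfAlgType k) (P : ore_hopf chi a H).
Context (s : nat) (ord_chi : has_order chi s).
Context (lambda : character k G) (gamma : k).
Local Notation V := (cyc_mod P ord_chi lambda gamma).

Definition cyc_basis (i : nat) : 'cV[k]_s := \col_(j < s) (i == j)%:R.
Local Notation m := cyc_basis.

Let ext (e : nat -> 'cV[k]_s) (v : 'cV[k]_s) := \sum_(j < s) v j 0 *: e j.

Definition cyc_g (g : G) : 'cV[k]_s -> 'cV[k]_s :=
  ext (fun i => (chi g ^+ i * lambda g) *: m i).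
Definition cyc_x : 'cV[k]_s -> 'cV[k]_s :=
  ext (fun i => if (i.+1 < s)%N then m i.+1 else gamma *: m 0).

Let extL e : linear (ext e).
Proof.
move=> c v w; rewrite /ext scaler_sumr -big_split; apply: eq_bigr => j _ /=.
by rewrite !mxE scalerDl scalerA.
Qed.

Let extE e (i : nat) : (i < s)%N -> ext e (m i) = e i.
Proof.
move=> si; rewrite /ext (bigD1 (Ordinal si)) //= mxE eqxx scale1r.
rewrite big1 ?addr0 // => j; rewrite -val_eqE /= mxE eq_sym => /negPf ->.
by rewrite scale0r.
Qed.

Let sum_m (v : 'cV[k]_s) : v = \sum_(j < s) v j 0 *: m j.
Proof.
apply/matrixP => i j; rewrite summxE (bigD1 i) //= !mxE eqxx mulr1 ord1.
rewrite big1 ?addr0 // => l; rewrite -val_eqE /= !mxE => /negPf ->.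
by rewrite mulr0.
Qed.


Let uL g : linear (cyc_g g). Proof. exact: extL. Qed.
Let yL : linear cyc_x. Proof. exact: extL. Qed.

Let lin_ext (f h : 'cV[k]_s -> 'cV[k]_s) : linear f -> linear h ->
  (forall i, (i < s)%N -> f (m i) = h (m i)) -> f =1 h.
Proof.
move=> fL hL fh v; rewrite [v]sum_m.
elim/big_ind: _ => [|z w IHz IHw|j _]; first by rewrite !lin0.
  by rewrite !linD ?IHz ?IHw.
by rewrite !linZ ?fh.
Qed.

Lemma cyc_gE g i : (i < s)%N -> cyc_g g (m i) = (chi g ^+ i * lambda g) *: m i.
Proof. exact: extE. Qed.
Lemma cyc_xE i : (i.+1 < s)%N -> cyc_x (m i) = m i.+1.
Proof. by move=> si; rewrite /cyc_x extE ?si // ltnW. Qed.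
Lemma cyc_x_last : cyc_x (m s.-1) = gamma *: m 0.
Proof.
by case: (ord_chi) => s0 _ _; rewrite /cyc_x extE ?prednK // ltnn.
Qed.

Let u1 v : cyc_g 1%g v = v.
Proof.
apply: (lin_ext (h := id)) v => // i si.
by rewrite cyc_gE // !char1 expr1n mulr1 scale1r.
Qed.

Let uM g h v : cyc_g (g * h)%g v = cyc_g g (cyc_g h v).
Proof.
apply: (lin_ext (h := cyc_g g \o cyc_g h)) v => // [c v w | i si] /=.
  by rewrite !uL.
by rewrite !cyc_gE // (linZ (uL _)) cyc_gE // scalerA !charM exprMn mulrACA mulrC.
Qed.

Let yu g v : cyc_x (cyc_g g v) = (chi^-1)%g g *: cyc_g g (cyc_x v).
Proof.
apply: (lin_ext (f := cyc_x \o cyc_g g)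
  (h := fun v => (chi^-1)%g g *: cyc_g g (cyc_x v))) v => [c v w|c v w|i si] /=.
- by rewrite uL yL.
- by rewrite yL uL scalerDr !scalerA mulrC.
case: (ord_chi) => s0 chis _.
rewrite cyc_gE // (linZ yL).
have := si; rewrite leq_eqVlt => /predU1P[is1|lti].
  have -> : i = s.-1 by rewrite -is1.
  rewrite cyc_x_last (linZ (uL _)) cyc_gE // expr0 mul1r !scalerA.
  have -> : chi g ^+ s.-1 = (chi g)^-1.
    apply: (mulfI (char_neq0 chi g)).
    by rewrite -exprS prednK // -char_XE chis mulfV // char_neq0.
  by congr (_ *: _); rewrite -!mulrA; congr (_ * _); rewrite mulrC.
rewrite cyc_xE // cyc_gE // scalerA exprS -!mulrA mulrA mulVf ?char_neq0 //.
by rewrite mul1r.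
Qed.

HB.instance Definition _ := GRing.Zmodule.copy V 'cV[k]_s.
HB.instance Definition _ := GRing.Zmodule_isLmodule.Build H V
  (ore_actM P uL yL uM yu) (ore_act1 P _ u1) (ore_actDr P uL yL)
  (ore_actDl P cyc_g cyc_x).

Lemma cyc_mod_og g i : (i < s)%N ->
  og P g *: (m i : V) = (chi g ^+ i * lambda g) *: m i :> 'cV_s.
Proof. by move=> si; rewrite -cyc_gE //; exact: (ore_act_og P cyc_g cyc_x). Qed.

Lemma cyc_mod_ox i : (i.+1 < s)%N -> ox P *: (m i : V) = m i.+1 :> 'cV_s.
Proof. by move=> si; rewrite -cyc_xE //; exact: (ore_act_ox P cyc_x u1). Qed.

Lemma cyc_mod_ox_last : ox P *: (m s.-1 : V) = gamma *: m 0 :> 'cV_s.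
Proof. by rewrite -cyc_x_last; exact: (ore_act_ox P cyc_x u1). Qed.

Lemma cyc_mod_scale (c : k) (v : V) :
  (c%:A : H) *: v = c *: (v : 'cV_s) :> 'cV_s.
Proof.
rewrite -(og1 P) [LHS](ore_actZ P cyc_g cyc_x) ore_act_og [cyc_g _ _]u1; by [].
Qed.

End CycMod.

(* Main.v *)
Require Import Defs.
From HB Require Import structures.
From mathcomp Require Import all_boot all_algebra.

Import GRing.Theory.
Local Open Scope ring_scope.

(** Tensoring with the line [V_lambda] does not change the underlying vector
    space: [n |-> 1 (x) n] and [n |-> n (x) 1] are linear bijections from N
    onto [V_lambda (x) N] and [N (x) V_lambda].  Since x kills [V_lambda] and
    comul x = x (x) a + 1 (x) x, transporting the action along them multiplies
    the action of each g by lambda(g), and multiplies that of x by 1 in the first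
    case and by lambda(a) in the second.  So each isomorphism amounts to a linear
    bijection between the two given modules that intertwines the actions of the
    group elements and of x up to these scalars ([char_tens_iso],
    [tens_char_iso]); that intertwining the generators suffices is [ore_linear].

    For [V_sigma] and [V_(lambda sigma)] the identity of k does it.  For the
    cyclic modules the diagonal map m_i |-> b^i m_i does: it multiplies the
    action of x by b, at the price of replacing alpha by alpha b^s, because the
    cycle m_0 -> ... -> m_(s-1) -> m_0 has s steps.  The first isomorphism of
    (b) is the case b = 1, the second the case b = lambda(a). *)

(** * Modules over H and the generators of H *)

Lemma hmod_iso_sym (R : pzRingType) (M N : lmodType R) :
  hmod_iso M N -> hmod_iso N M.
Proof.
case=> f [g fK gK].
pose G : {linear N -> M} :=
  HB.pack g (GRing.isLinear.Build R N M *:%R g (can2_linear fK gK)).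
by exists G; exists f.
Qed.

Section OreModules.
Set Implicit Arguments.
Unset Strict Implicit.
Variables (k : fieldType) (G : groupType) (chi : character k G) (a : G).
Variables (H : hopfAlgType k) (P : ore_hopf chi a H).
Local Notation res := restrict_scalars.

(** H is spanned by the products g x^i, so a k-linear map that commutes with the
    actions of G and of x is H-linear. *)
Lemma ore_linear (M N : lmodType H) (f : res M -> res N) :
  linear f ->
  (forall g (m : M), f (og P g *: m) = og P g *: (f m : N)) ->
  (forall m : M, f (ox P *: m) = ox P *: (f m : N)) ->
  linear (f : M -> N).
Proof.
move=> fL fg fx.
suff fZ (h : H) (m : M) : f (h *: m) = h *: (f m : N).
  by move=> h m m'; rewrite -fZ; exact: (linD fL).
have fX i (m' : M) : f (ox P ^+ i *: m') = ox P ^+ i *: (f m' : N).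
  elim: i => [|i IHi]; first by rewrite expr0 !scale1r.
  by rewrite exprS -!scalerA fx IHi.
have [c _ cK] := ore_basis P; rewrite -[h]cK.
elim/fg_ind: (c h) => [|d [g i] t IHt].
  by rewrite fglift0 !scale0r; exact: (lin0 fL).
rewrite fglift_linear fgliftU1 /= [in LHS]scalerDl [RHS]scalerDl -IHt.
rewrite [LHS](linD fL); congr (_ + _).
rewrite -mulr_algl -[in LHS]scalerA -[RHS]scalerA [LHS](linZ fL) restrict_scaleE.
by rewrite -[in LHS]scalerA -[in RHS]scalerA fg fX.
Qed.

Lemma scale_linear (M : lmodType H) (h : H) :
  linear (fun m : res M => h *: (m : M) : res M).
Proof. exact: (restrict_bilinear M).2. Qed.

(** The k-structure that a tensor product of H-modules gets from H, through the
    coproduct, is that of the tensor product over k. *)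
Lemma hmod_tens_scalar (M N : lmodType H) (c : k) (t : hmod_tens M N) :
  (c%:A : H) *: t = c *: (t : tens (res M) (res N)) :> tens (res M) (res N).
Proof.
rewrite hmod_tens_scaleE (linZ comul_linear) comul_morphism.1.
have aB := tens_map2_bilinear (restrict_bilinear M) (restrict_bilinear N).
by rewrite [LHS](linZ (aB.1 t)) [X in _ *: X]tens_act1.
Qed.

Lemma hmod_tens_og (M N : lmodType H) g (m : res M) (n : res N) :
  og P g *: (tensor m n : hmod_tens M N) =
  tensor (og P g *: (m : M) : res M) (og P g *: (n : N) : res N)
    :> tens (res M) (res N).
Proof. by rewrite hmod_tens_scaleE comul_og tens_actE. Qed.

Lemma hmod_tens_ox (M N : lmodType H) (m : res M) (n : res N) :
  ox P *: (tensor m n : hmod_tens M N) =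
  tensor (ox P *: (m : M) : res M) (og P a *: (n : N) : res N) +
  tensor m (ox P *: (n : N) : res N) :> tens (res M) (res N).
Proof.
have aB := tens_map2_bilinear (restrict_bilinear M) (restrict_bilinear N).
rewrite hmod_tens_scaleE comul_ox [LHS](linD (aB.1 _)) -!/(tens_act _ _).
by rewrite !tens_actE scale1r.
Qed.

(** * Tensoring with a one-dimensional module *)

Section CharTensor.
Variable lambda : character k G.
Local Notation V := (char_mod P lambda).
Local Notation e := (1%R : k).

Lemma char_mod_gen (v : res V) : v = (v : k) *: (e : res V) :> res V.
Proof. by rewrite restrict_scaleE; apply/esym; rewrite [LHS]char_mod_scale mulr1. Qed.

Lemma char_mod_og_gen g : og P g *: (e : V) = lambda g *: (e : res V) :> res V.
Proof. by rewrite restrict_scaleE [LHS]char_mod_og [RHS]char_mod_scale. Qed.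

(** A tensor with a line is k-linearly the other factor; the inverse sends
    [tensor v n] to [v *: n], a vector of the line being a scalar. *)
Lemma tensor_gen_bij (N : lmodType k) :
  bijective (fun n : N => tensor (e : res V) n).
Proof.
have B : bilinear_for *:%R *:%R (fun (v : res V) (n : N) => (v : k) *: n).
  split=> [n c v w | v c n n'] /=.
    by rewrite restrict_scaleE [in LHS]char_mod_scale scalerDl scalerA.
  by rewrite scalerDr !scalerA mulrC.
exists (tens_lift (fun (v : res V) (n : N) => (v : k) *: n)) => [n | t].
  by rewrite tens_liftE // scale1r.
move: t; apply: tens_linear_ext => // [|v n].
  by move=> c s t; rewrite (tens_lift_linear B) linearPr.
by rewrite tens_liftE // linearZr -linearZl_LR -char_mod_gen.
Qed.

Lemma tensor_genr_bij (N : lmodType k) :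
  bijective (fun n : N => tensor n (e : res V)).
Proof.
have B : bilinear_for *:%R *:%R (fun (n : N) (v : res V) => (v : k) *: n).
  split=> [v c n n' | n c v w] /=.
    by rewrite scalerDr !scalerA mulrC.
  by rewrite restrict_scaleE [in LHS]char_mod_scale scalerDl scalerA.
exists (tens_lift (fun (n : N) (v : res V) => (v : k) *: n)) => [n | t].
  by rewrite tens_liftE // scale1r.
move: t; apply: tens_linear_ext => // [|n v].
  by move=> c s t; rewrite (tens_lift_linear B) linearPl.
by rewrite tens_liftE // linearZl_LR -linearZr -char_mod_gen.
Qed.

Section Iso.
Variables (N N' : lmodType H) (d : res N' -> res N).
Hypotheses (dL : linear d) (d_bij : bijective d).
Hypothesis d_og : forall g (n : N'),
  d (og P g *: n) = lambda g *: (og P g *: (d n : N) : res N).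

(** The coproduct of x sends [tensor 1 n] to [tensor (x 1) (a n)], which vanishes
    as x kills the line, plus [tensor 1 (x n)]: x acts untwisted. *)
Lemma char_tens_iso :
  (forall n : N', d (ox P *: n) = ox P *: (d n : N)) ->
  hmod_iso (hmod_tens V N) N'.
Proof.
move=> d_ox; apply: hmod_iso_sym.
pose f (n : res N') : res (hmod_tens V N) := tensor (e : res V) (d n).
have fL : linear f.
  move=> c n n'; rewrite /f dL linearPr; congr (_ + _).
  by rewrite restrict_scaleE [RHS]hmod_tens_scalar.
have fH : linear (f : N' -> hmod_tens V N).
  apply: ore_linear => // [g n | n]; rewrite /f.
    rewrite d_og [RHS]hmod_tens_og char_mod_og_gen.
    by rewrite linearZr linearZl_LR.
  rewrite d_ox [RHS]hmod_tens_ox char_mod_ox.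
  by rewrite linear0l add0r.
pose F : {linear N' -> hmod_tens V N} :=
  HB.pack (f : N' -> hmod_tens V N) (GRing.isLinear.Build H _ _ *:%R f fH).
by exists F; exact: bij_comp (tensor_gen_bij _) d_bij.
Qed.

(** Now the surviving term of the coproduct of x is [tensor (x n) (a 1)], and a
    acts on the line by [lambda a]: this is the twist in the action of x. *)
Lemma tens_char_iso :
  (forall n : N', d (ox P *: n) = lambda a *: (ox P *: (d n : N) : res N)) ->
  hmod_iso (hmod_tens N V) N'.
Proof.
move=> d_ox; apply: hmod_iso_sym.
pose f (n : res N') : res (hmod_tens N V) := tensor (d n) (e : res V).
have fL : linear f.
  move=> c n n'; rewrite /f dL linearPl; congr (_ + _).
  by rewrite restrict_scaleE [RHS]hmod_tens_scalar.
have fH : linear (f : N' -> hmod_tens N V).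
  apply: ore_linear => // [g n | n]; rewrite /f.
    rewrite d_og [RHS]hmod_tens_og char_mod_og_gen.
    by rewrite linearZr linearZl_LR.
  rewrite d_ox [RHS]hmod_tens_ox char_mod_ox char_mod_og_gen.
  by rewrite linear0r addr0 linearZr linearZl_LR.
pose F : {linear N' -> hmod_tens N V} :=
  HB.pack (f : N' -> hmod_tens N V) (GRing.isLinear.Build H _ _ *:%R f fH).
by exists F; exact: bij_comp (tensor_genr_bij _) d_bij.
Qed.

End Iso.
End CharTensor.

(** * Cyclic modules *)

Section Cyclic.
Variables (s : nat) (chi_s : has_order chi s).
Implicit Types (lambda : character k G) (gamma : k).
Local Notation m i := (cyc_basis k s i).

(** The k-action on [cyc_mod] that comes from H is the coordinatewise one, so
    [cyc_mod] may be handled as a space of column vectors. *)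
Lemma cyc_mod_scaleE lambda gamma c (v : res (cyc_mod P chi_s lambda gamma)) :
  c *: v = c *: (v : 'cV[k]_s) :> 'cV[k]_s.
Proof. by rewrite restrict_scaleE [LHS]cyc_mod_scale. Qed.

Lemma cyc_mod_ext lambda gamma (W : lmodType k)
    (f h : res (cyc_mod P chi_s lambda gamma) -> W) :
  linear f -> linear h -> (forall i, (i < s)%N -> f (m i) = h (m i)) -> f =1 h.
Proof.
move=> fL hL fh v.
have -> : v = \sum_(j < s) (v : 'cV_s) j 0 *: m j :> 'cV_s.
  apply/matrixP => i j; rewrite summxE (bigD1 i) //= !mxE eqxx mulr1 ord1.
  rewrite big1 ?addr0 // => l; rewrite -val_eqE /= !mxE => /negPf ->.
  by rewrite mulr0.
elim/big_ind: _ => [|z w IHz IHw|j _].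
- by rewrite [LHS](lin0 fL) [RHS](lin0 hL).
- by rewrite [LHS](linD fL) [RHS](linD hL) IHz IHw.
by rewrite -(@cyc_mod_scaleE lambda gamma) (linZ fL) (linZ hL) fh.
Qed.

(** Both sides are k-linear in [v], which leaves the basis vectors. *)
Lemma cyc_mod_semilinear lambda gamma (M : lmodType H) c h
    (d : res (cyc_mod P chi_s lambda gamma) -> res M) :
  linear d ->
  (forall i, (i < s)%N -> d (h *: (m i : cyc_mod P chi_s lambda gamma)) =
                          c *: (h *: (d (m i) : M) : res M)) ->
  forall v : cyc_mod P chi_s lambda gamma,
    d (h *: v) = c *: (h *: (d v : M) : res M).
Proof.
move=> dL dh; apply: (@cyc_mod_ext lambda gamma) => // u v w /=.
  by rewrite [X in d X]scale_linear dL.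
by rewrite dL [X in c *: X]scale_linear [LHS]scalerDr !scalerA mulrC.
Qed.

Definition rescale (b : k) (v : 'cV[k]_s) : 'cV[k]_s :=
  \col_j (b ^+ j * v j 0).

Lemma rescale_linear b : linear (rescale b).
Proof.
by move=> c v w; apply/matrixP => i j; rewrite !mxE mulrDr mulrCA.
Qed.

Lemma rescale_basis b i : (i < s)%N -> rescale b (m i) = b ^+ i *: m i.
Proof.
move=> si; apply/matrixP => j l; rewrite !mxE.
by have [-> | _] := eqVneq i j; rewrite ?mulr0.
Qed.

Lemma rescale_bij b : b != 0 -> bijective (rescale b).
Proof.
move=> b0; exists (rescale b^-1) => v; apply/matrixP => i j; rewrite !mxE ord1.
  by rewrite mulrA -exprMn mulVf // expr1n mul1r.
by rewrite mulrA -exprMn mulfV // expr1n mul1r.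
Qed.

Section Rescale.
Variables (sigma lambda : character k G) (b alpha : k).
Local Notation N := (cyc_mod P chi_s sigma alpha).
Local Notation N' := (cyc_mod P chi_s (lambda * sigma)%g (alpha * b ^+ s)).
Let d : res N' -> res N := rescale b.

Lemma rescale_mod_linear : linear d.
Proof.
move=> c v w; rewrite cyc_mod_scaleE [in RHS]cyc_mod_scaleE.
exact: rescale_linear.
Qed.

(** g is diagonal too, so [rescale b] commutes with it; only the change of
    character from [sigma] to [lambda * sigma] contributes. *)
Lemma rescale_og g (v : N') :
  d (og P g *: v) = lambda g *: (og P g *: (d v : N) : res N).
Proof.
apply: cyc_mod_semilinear v; first exact: rescale_mod_linear.
move=> i si; rewrite cyc_mod_scaleE /d.
rewrite [og P g *: _ in LHS]cyc_mod_og //.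
rewrite (linZ (rescale_linear b)) rescale_basis //.
rewrite -(@cyc_mod_scaleE sigma alpha (b ^+ i)).
rewrite [og P g *: _ in RHS](linZ (scale_linear _)).
rewrite cyc_mod_scaleE [in RHS]cyc_mod_scaleE cyc_mod_og // !scalerA.
have -> : chi g ^+ i * (lambda * sigma)%g g * b ^+ i =
    lambda g * b ^+ i * (chi g ^+ i * sigma g).
  by rewrite /= mulrCA -!mulrA; congr (_ * _); rewrite mulrA mulrC.
by [].
Qed.

(** Each step [m_i -> m_(i+1)] gains a factor b; the last one, which returns to
    m_0, would lose b^(s-1) instead, and the parameter [alpha * b ^+ s] makes
    up for it. *)
Lemma rescale_ox (v : N') : d (ox P *: v) = b *: (ox P *: (d v : N) : res N).
Proof.
apply: cyc_mod_semilinear v; first exact: rescale_mod_linear.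
move=> i si; rewrite cyc_mod_scaleE /d rescale_basis //.
rewrite -(@cyc_mod_scaleE sigma alpha (b ^+ i)).
rewrite [ox P *: _ in RHS](linZ (scale_linear _)) cyc_mod_scaleE scalerA -exprS.
have [lt_is | ge_is] := ltnP i.+1 s.
  by rewrite ![ox P *: _]cyc_mod_ox // rescale_basis.
have s_i : s = i.+1 by apply/eqP; rewrite eqn_leq ge_is.
have -> : i = s.-1 by rewrite s_i.
rewrite ![ox P *: _]cyc_mod_ox_last (linZ (rescale_linear b)) rescale_basis ?s_i //.
by rewrite expr0 !scalerA mulr1 mulrC (ltn_predK si).
Qed.
End Rescale.

End Cyclic.
End OreModules.

(** * The isomorphisms *)

Theorem proposition3p17 (k : fieldType) (G : groupType) (chi : character k G)
    (a : G) (a_central : forall g : G, (a * g = g * a)%g) (chi_a : chi a != 1)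
    (H : hopfAlgType k) (P : ore_hopf chi a H)
    (sigma lambda : character k G) (alpha : k) :
  hmod_iso (hmod_tens (char_mod P lambda) (char_mod P sigma))
           (char_mod P (lambda * sigma)%g) /\
  (forall (s : nat) (chi_s : has_order chi s),
    hmod_iso (hmod_tens (char_mod P lambda) (cyc_mod P chi_s sigma alpha))
             (cyc_mod P chi_s (lambda * sigma)%g alpha) /\
    hmod_iso (hmod_tens (cyc_mod P chi_s sigma alpha) (char_mod P lambda))
             (cyc_mod P chi_s (sigma * lambda)%g (alpha * lambda a ^+ s))).
Proof.
have charC (mu nu : character k G) : (mu * nu = nu * mu)%g.
  by apply: char_eq => g; exact: mulrC.
split=> [|s chi_s].
  pose d (v : restrict_scalars (char_mod P (lambda * sigma)%g)) :
    restrict_scalars (char_mod P sigma) := v.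
  apply: (char_tens_iso (d := d)); rewrite /d.
  - move=> c v w; rewrite !restrict_scaleE [in LHS]char_mod_scale.
    by rewrite [in RHS]char_mod_scale.
  - by exists d.
  - move=> g v; rewrite restrict_scaleE [RHS]char_mod_scale.
    by rewrite [LHS]char_mod_og [og P g *: _]char_mod_og mulrA.
  by move=> v; rewrite [LHS]char_mod_ox [RHS]char_mod_ox.
split.
  suff : hmod_iso (hmod_tens (char_mod P lambda) (cyc_mod P chi_s sigma alpha))
                  (cyc_mod P chi_s (lambda * sigma)%g (alpha * 1 ^+ s)).
    by rewrite expr1n mulr1.
  apply: (char_tens_iso (@rescale_mod_linear _ _ _ _ _ P _ chi_s _ _ 1 _)).
  - exact: rescale_bij (oner_neq0 k).
  - exact: rescale_og.
  by move=> v; rewrite [LHS]rescale_ox scale1r.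
rewrite charC.
apply: (tens_char_iso (@rescale_mod_linear _ _ _ _ _ P _ chi_s _ _ (lambda a) _)).
- exact: rescale_bij (char_neq0 lambda a).
- exact: rescale_og.
exact: rescale_ox.
Qed.
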